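(* Let $X$ be a continuous positive random variable with probability density function $f$, such that the function $x\longmapsto x f(x)$ on $]0,+\infty[$ satisfies the following: there exists $a>0$ such that (1) $\max_{x>0} x f(x) = m = a f(a)$, and (2) $x\longmapsto x f(x)$ is nondecreasing on $]0,a]$ and nonincreasing on $[a,+\infty[$. Then, for any $z\in\,]0,1]$, $$\left\vert P\left(\{\log X\}<z\right)-z\right\vert < 2\ln(10)\, m.$$ In particular, if $(X_n)$ is a sequence of continuous positive random variables with probability density functions $f_n$ each satisfying these conditions (with $a=a_n$ allowed to depend on $n$), and if $m_n=\max_{x>0} x f_n(x)\longrightarrow 0$ as $n\to\infty$, then $\{\log (X_n)\}$ converges in law to the uniform distribution on $[0,1[$.
   Context: Here $\log$ denotes the base $10$ logarithm and $\ln$ the natural logarithm. For a real number $x$, $\lfloor x\rfloor$ is the greatest integer not exceeding $x$ and $\{x\}=x-\lfloor x\rfloor$ is its fractional part. A continuous random variable is one admitting a probability density function with respect to Lebesgue measure. Intervals are written in the notation $]a,b]=(a,b]$, $[a,b[\,=[a,b)$, etc. *)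

(* Defs.v *)
From HB Require Import structures.
From mathcomp Require Import all_boot all_order all_algebra.
From mathcomp Require Import all_classical all_reals all_analysis.
From mathcomp Require Import measurable_realfun.

Set Implicit Arguments.
Unset Strict Implicit.
Unset Printing Implicit Defensive.

Import Order.TTheory GRing.Theory Num.Theory.
Import numFieldNormedType.Exports.

Local Open Scope classical_set_scope.
Local Open Scope ring_scope.

(* As [ln x = 0] for [x <= 0], [log10] is a total function. *)
Definition log10 (R : realType) (x : R) : R := ln x / ln 10.

Definition fracpart (R : realType) (x : R) : R := x - (Num.floor x)%:~R.

Lemma measurable_fracpart (R : realType) : measurable_fun [set: R] (@fracpart R).
Proof.
apply: measurable_funB => //; apply: nondecreasing_measurable => // x y xy.
by rewrite ler_int; exact: Num.Theory.le_floor.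
Qed.

Lemma measurable_log10 (R : realType) : measurable_fun [set: R] (@log10 R).
Proof. by apply: measurable_funM => //; exact: measurable_ln. Qed.

HB.instance Definition _ (R : realType) :=
  isMeasurableFun.Build _ _ _ _ (@fracpart R) (@measurable_fracpart R).

HB.instance Definition _ (R : realType) :=
  isMeasurableFun.Build _ _ _ _ (@log10 R) (@measurable_log10 R).

Definition fracpart_log10 d (T : measurableType d) (R : realType)
    (P : probability T R) (X : {RV P >-> R}) : {RV P >-> R} :=
  (@fracpart R \o (@log10 R \o X))%FUN.

Definition has_pdf d (T : measurableType d) (R : realType)
    (P : probability T R) (X : {RV P >-> R}) (f : R -> R) : Prop :=
  [/\ measurable_fun [set: R] f,
      (forall x, 0 <= f x) &
      (forall A : set R, measurable A ->
        distribution P X A = \int[lebesgue_measure]_(x in A) (f x)%:E)%E].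

Definition positive_RV d (T : measurableType d) (R : realType)
    (P : probability T R) (X : {RV P >-> R}) : Prop :=
  {ae P, forall w, 0 < X w}.

(* The second and third conjuncts say [max_(x > 0) x f(x) = m = a f(a)]. *)
Definition unimodal_at (R : realType) (f : R -> R) (m a : R) : Prop :=
  [/\ 0 < a,
      (forall x, 0 < x -> x * f x <= m),
      m = a * f a,
      {in `]0, a] &, nondecreasing_fun (fun x => x * f x)} &
      {in `[a, +oo[ &, nonincreasing_fun (fun x => x * f x)}].

(* Convergence of the distribution functions at every continuity point of the
   limiting one. Each variable may live on its own probability space. *)
Definition cvg_in_law (R : realType) (d : nat -> measure_display)
    (T : forall n, measurableType (d n)) (P : forall n, probability (T n) R)
    (Y : forall n, {RV (P n) >-> R})
    (nu : probability (measurableTypeR R) R) : Prop :=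
  forall r : R, {for r, continuous (fun t : R => nu `]-oo, t]%classic)} ->
    cdf (Y n) r @[n --> \oo] --> nu `]-oo, r]%classic.

(* Main.v *)
(* Let Y = log X, which has density g(t) = ln 10 * 10^t f(10^t); g is at most
   M = ln 10 * m, and is nondecreasing before b = log a and nonincreasing after
   it. Write J_k and I_k for the masses that Y gives to [k, k + z[ and
   [k, k + 1[. Where g decreases, J_(k+1) <= z I_k <= J_k; where it increases,
   z I_(k-1) <= J_k <= z I_k. Summing over the integers on each side of
   floor b, only two cells near b are not compared with each other, and each
   contributes at most z M, hence |P({Y} < z) - z| <= 2 z M. This is < 2 M when
   z < 1, and for z = 1 the left-hand side is 0. No change of variables is
   needed: if g <= c on [u, v] then f(x) <= (c / ln 10) / x on [10^u, 10^v], so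
   Y gives [u, v[ a mass at most c (v - u), and likewise from below. *)
Require Import Defs.
From HB Require Import structures.
From mathcomp Require Import all_boot all_order all_algebra.
From mathcomp Require Import all_classical all_reals all_analysis.
From mathcomp Require Import measurable_realfun lra zify.

Set Implicit Arguments.
Unset Strict Implicit.
Unset Printing Implicit Defensive.

Import Order.TTheory GRing.Theory Num.Theory.
Import numFieldNormedType.Exports.

Local Open Scope classical_set_scope.
Local Open Scope ring_scope.

(** * Sets of reals defined through integer and fractional parts *)

Section Windows.
Context {R : realType}.
Implicit Types (z : R) (k : int) (D : set int).

(* For z <= 1, the union of the intervals [k, k + z[ over the k in D. *)
Definition windows z D : set R :=
  [set x | D (Num.floor x) /\ fracpart x < z].

Lemma windows1 z k : z <= 1 ->
  windows z [set k] = `[k%:~R, k%:~R + z[%classic.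
Proof.
move=> z1; apply/seteqP; split=> x /=; rewrite in_itv /=.
  move=> [<-]; rewrite /fracpart => xz.
  by rewrite floor_le /=; lra.
move=> /andP[kx xk].
have fx : Num.floor x = k by apply: floor_def; rewrite intrD kx /=; lra.
by split=> //; rewrite /fracpart fx; lra.
Qed.

Lemma fracpart_ge0 (x : R) : 0 <= fracpart x.
Proof. by rewrite /fracpart subr_ge0 floor_le. Qed.

Lemma fracpart_lt1 (x : R) : fracpart x < 1.
Proof. by have := floorD1_gt x; rewrite intrD /fracpart; lra. Qed.

Lemma measurable_windows z D : measurable (windows z D).
Proof.
(* A fractional part is below 1, so truncating [z] at 1 leaves the set unchanged and makes
   [windows1] applicable for every [z]. *)
suff -> : windows z D =
    (\bigcup_(k in D) `[k%:~R, k%:~R + Num.min z 1[%classic).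
  rewrite bigcup_mkcond; apply: countable_bigcupT_measurable => // k.
  by case: ifP => // _; exact: measurable0.
apply/seteqP; split=> x /=.
  move=> [Dx xz]; exists (Num.floor x) => //=.
  rewrite in_itv /= floor_le /= -ltrBlDl lt_min.
  by apply/andP; split; [exact: xz|exact: fracpart_lt1].
move=> [k Dk]; rewrite -windows1 ?ge_min ?lexx ?orbT // => -[/= fxk].
by rewrite /windows /= fxk lt_min => /andP[].
Qed.

Lemma windowsU z D D' : windows z (D `|` D') = windows z D `|` windows z D'.
Proof.
apply/seteqP; split=> x /=; rewrite /windows /=; first by move=> [[]]; tauto.
by move=> [[]|[]]; tauto.
Qed.

Lemma windows_bigcup z (e : nat -> int) :
  windows z (range e) = \bigcup_n windows z [set e n].
Proof.
apply/seteqP; split=> x.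
  by move=> [[n _ en] xz]; exists n.
by move=> [n _ [/= en xz]]; split=> //; exists n.
Qed.

Lemma trivIset_windows z (e : nat -> int) : injective e ->
  trivIset [set: nat] (fun n => windows z [set e n]).
Proof.
move=> inj_e i j _ _ [x [[/= ei _] [/= ej _]]].
by apply: inj_e; rewrite -ei.
Qed.

(** * Masses of windows under a probability on the line *)

Context (mu : probability R R).

Definition wgt z D : R := fine (mu (windows z D)).

Lemma wgtE z D : mu (windows z D) = (wgt z D)%:E.
Proof. by rewrite fineK // fin_num_measure //; exact: measurable_windows. Qed.

Lemma wgtU z D D' : D `&` D' = set0 -> wgt z (D `|` D') = wgt z D + wgt z D'.
Proof.
move=> DD'; apply: EFin_inj; rewrite EFinD -!wgtE windowsU measureU //.
- exact: measurable_windows.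
- exact: measurable_windows.
apply/seteqP; split=> // x [[Dx _] [D'x _]].
by suff : set0 (Num.floor x) by []; rewrite -DD'.
Qed.

(** Countable additivity along each enumeration reduces the claim to a termwise comparison of
    series. Allowing two enumerations lets a cell be compared with its neighbour. *)
Lemma wgt_transfer (c z z' : R) (e e' : nat -> int) : 0 <= c ->
  injective e -> injective e' ->
  (forall n, wgt z [set e n] <= c * wgt z' [set e' n]) ->
  wgt z (range e) <= c * wgt z' (range e').
Proof.
move=> c0 inje inje' le; rewrite -lee_fin EFinM -!wgtE !windows_bigcup.
rewrite !measure_bigcup;
  try by [exact: trivIset_windows|move=> i _; exact: measurable_windows].
rewrite -nneseriesZl // lee_nneseries // => n _.
by have := le n; rewrite -lee_fin EFinM -!wgtE; exact.
Qed.

(** * Comparison of neighbouring cells under a unimodal density *)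

Context (g : R -> R) (b M : R).
Hypothesis g_le : forall t, g t <= M.
Hypothesis g_incr : forall s t, s <= t -> t <= b -> g s <= g t.
Hypothesis g_decr : forall s t, b <= s -> s <= t -> g t <= g s.

Definition mu_itv (u v : R) : R := fine (mu `[u, v[%classic).

(** The measure is tied to [g] only through these two bounds, so [g] itself is never integrated. For
    log X they are supplied by [log_law_le] and [log_law_ge]. *)
Hypothesis mu_itv_le : forall u v c, u <= v ->
  (forall t, u <= t <= v -> g t <= c) -> mu_itv u v <= c * (v - u).
Hypothesis mu_itv_ge : forall u v c, u <= v ->
  (forall t, u <= t <= v -> c <= g t) -> c * (v - u) <= mu_itv u v.

Lemma mu_itvD u v w : u <= v -> v <= w ->
  mu_itv u w = mu_itv u v + mu_itv v w.
Proof.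
move=> uv vw; rewrite /mu_itv -fineD ?fin_num_measure //; last first.
rewrite -measureU //.
  congr (fine (mu _)); apply/seteqP; split=> x /=; rewrite !in_itv /=.
    move=> /andP[ux xw]; case: (ltP x v) => xv; [left|right];
      by apply/andP.
  by move=> [|] /andP[xu xv]; apply/andP; split; lra.
apply/seteqP; split=> x //=; rewrite !in_itv /= => -[/andP[_ xv] /andP[vx _]].
by lra.
Qed.

Lemma mu_itv_le_M z u : 0 < z -> z <= 1 -> mu_itv u (u + z) <= z * M.
Proof.
move=> z0 _; have := @mu_itv_le u (u + z) M.
by rewrite addrAC subrr add0r mulrC; apply=> [|t _]; [lra|exact: g_le].
Qed.

(** The value [g (u + z)] separates the mean densities of the two pieces of the cell. With A and B
    their masses, A >= z g(u + z) and B <= (1 - z) g(u + z), so z B <= (1 - z) A. *)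
Lemma decr_head z u : 0 < z -> z <= 1 -> b <= u ->
  z * mu_itv u (u + 1) <= mu_itv u (u + z).
Proof.
move=> z0 z1 bu; rewrite (@mu_itvD u (u + z) (u + 1)); [|lra..].
have H1 : g (u + z) * (u + z - u) <= mu_itv u (u + z).
  by apply: mu_itv_ge => [|t /andP[ut tz]]; [lra|apply: g_decr; lra].
have H2 : mu_itv (u + z) (u + 1) <= g (u + z) * (u + 1 - (u + z)).
  by apply: mu_itv_le => [|t /andP[ut tz]]; [lra|apply: g_decr; lra].
have z1' : 0 <= 1 - z by lra.
by have := ler_wpM2l z1' H1; have := ler_wpM2l (ltW z0) H2; lra.
Qed.

(** Here the separating value is [g (u + 1)], taken at the common endpoint of the two intervals. *)
Lemma decr_next z u : 0 < z -> z <= 1 -> b <= u ->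
  mu_itv (u + 1) (u + 1 + z) <= z * mu_itv u (u + 1).
Proof.
move=> z0 z1 bu.
have H1 : g (u + 1) * (u + 1 - u) <= mu_itv u (u + 1).
  by apply: mu_itv_ge => [|t /andP[ut tz]]; [lra|apply: g_decr; lra].
have H2 : mu_itv (u + 1) (u + 1 + z) <= g (u + 1) * (u + 1 + z - (u + 1)).
  by apply: mu_itv_le => [|t /andP[ut tz]]; [lra|apply: g_decr; lra].
by have := ler_wpM2l (ltW z0) H1; lra.
Qed.

(** Mirror image of [decr_head], with the same separating value [g (u + z)]. *)
Lemma incr_head z u : 0 < z -> z <= 1 -> u + 1 <= b ->
  mu_itv u (u + z) <= z * mu_itv u (u + 1).
Proof.
move=> z0 z1 bu; rewrite (@mu_itvD u (u + z) (u + 1)); [|lra..].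
have H1 : mu_itv u (u + z) <= g (u + z) * (u + z - u).
  by apply: mu_itv_le => [|t /andP[ut tz]]; [lra|apply: g_incr; lra].
have H2 : g (u + z) * (u + 1 - (u + z)) <= mu_itv (u + z) (u + 1).
  by apply: mu_itv_ge => [|t /andP[ut tz]]; [lra|apply: g_incr; lra].
have z1' : 0 <= 1 - z by lra.
by have := ler_wpM2l z1' H1; have := ler_wpM2l (ltW z0) H2; lra.
Qed.

(** Mirror image of [decr_next], with separating value [g u]. *)
Lemma incr_prev z u : 0 < z -> u + z <= b ->
  z * mu_itv (u - 1) u <= mu_itv u (u + z).
Proof.
move=> z0 bu.
have H1 : mu_itv (u - 1) u <= g u * (u - (u - 1)).
  by apply: mu_itv_le => [|t /andP[ut tz]]; [lra|apply: g_incr; lra].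
have H2 : g u * (u + z - u) <= mu_itv u (u + z).
  by apply: mu_itv_ge => [|t /andP[ut tz]]; [lra|apply: g_incr; lra].
by have := ler_wpM2l (ltW z0) H1; lra.
Qed.

Lemma wgt_mu_itv z k : z <= 1 -> wgt z [set k] = mu_itv k%:~R (k%:~R + z).
Proof. by move=> z1; rewrite /wgt windows1. Qed.

(** * Summation over half-lines of integers *)

Definition above k : set int := range (fun n : nat => k + n%:Z).
Definition below k : set int := range (fun n : nat => k - n%:Z).

Lemma above_inj k : injective (fun n : nat => k + n%:Z).
Proof. by move=> i j /addrI []. Qed.

Lemma below_inj k : injective (fun n : nat => k - n%:Z).
Proof. by move=> i j /addrI /oppr_inj []. Qed.

Lemma aboveE k : above k = [set j | (k <= j)%R].
Proof.
apply/seteqP; split=> j /=; first by move=> [n _ <-]; lia.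
by move=> kj; exists `|j - k|%N => //; lia.
Qed.

Lemma belowE k : below k = [set j | (j <= k)%R].
Proof.
apply/seteqP; split=> j /=; first by move=> [n _ <-]; lia.
by move=> kj; exists `|j - k|%N => //; lia.
Qed.

Lemma above1U k : above k = [set k] `|` above (k + 1).
Proof.
rewrite !aboveE; apply/seteqP; split=> j /=; last by move=> [->|]; lia.
by move=> kj; case: (eqVneq j k) => [->|]; [left|right; lia].
Qed.

Lemma below1U k : below k = [set k] `|` below (k - 1).
Proof.
rewrite !belowE; apply/seteqP; split=> j /=; last by move=> [->|]; lia.
by move=> kj; case: (eqVneq j k) => [->|]; [left|right; lia].
Qed.

Lemma wgt_above z k : wgt z (above k) = wgt z [set k] + wgt z (above (k + 1)).
Proof.
rewrite above1U wgtU // aboveE; apply/seteqP; split=> // j [/= ->] /=; lia.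
Qed.

Lemma wgt_below z k : wgt z (below k) = wgt z [set k] + wgt z (below (k - 1)).
Proof.
rewrite below1U wgtU // belowE; apply/seteqP; split=> // j [/= ->] /=; lia.
Qed.

Lemma wgtT z k : wgt z setT = wgt z (below (k - 1)) + wgt z (above k).
Proof.
rewrite -wgtU.
  congr wgt; rewrite aboveE belowE; apply/seteqP; split=> // j _ /=.
  by case: (leP k j) => kj; [right|left; lia].
by rewrite aboveE belowE; apply/seteqP; split=> // j [/=]; lia.
Qed.

Lemma wgt1T : wgt 1 setT = 1.
Proof.
rewrite /wgt (_ : windows 1 setT = setT) ?probability_setT //.
by apply/seteqP; split=> // x _; split=> //; exact: fracpart_lt1.
Qed.

Lemma wgt_ge0 z D : 0 <= wgt z D.
Proof. exact: fine_ge0. Qed.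

Lemma wgt_above_ge z k : 0 < z -> z <= 1 -> b <= k%:~R ->
  z * wgt 1 (above k) <= wgt z (above k).
Proof.
(* [wgt_transfer] has its constant on the right, so it is used with [z^-1]. *)
move=> z0 z1 bk; rewrite -ler_pdivlMl //; apply: wgt_transfer.
- by rewrite invr_ge0 ltW.
- exact: above_inj.
- exact: above_inj.
move=> n; rewrite ler_pdivlMl // !wgt_mu_itv //.
apply: decr_head; rewrite ?intrD //.
have : 0 <= n%:~R :> R by rewrite ler0z.
lra.
Qed.

Lemma wgt_above_le z k : 0 < z -> z <= 1 -> b <= k%:~R ->
  wgt z (above (k + 1)) <= z * wgt 1 (above k).
Proof.
move=> z0 z1 bk; apply: wgt_transfer.
- exact: ltW.
- exact: above_inj.
- exact: above_inj.
(* Cell k + 1 + n is read as the successor of cell k + n. *)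
move=> n; rewrite !wgt_mu_itv // [k + 1 + _]addrAC (intrD _ (k + n%:Z)).
apply: decr_next; rewrite ?intrD //.
have : 0 <= n%:~R :> R by rewrite ler0z.
lra.
Qed.

Lemma wgt_below_le z k : 0 < z -> z <= 1 -> k%:~R + 1 <= b ->
  wgt z (below k) <= z * wgt 1 (below k).
Proof.
move=> z0 z1 bk; apply: wgt_transfer.
- exact: ltW.
- exact: below_inj.
- exact: below_inj.
move=> n; rewrite !wgt_mu_itv //.
apply: incr_head; rewrite ?intrB //.
have : 0 <= n%:~R :> R by rewrite ler0z.
lra.
Qed.

Lemma wgt_below_ge z k : 0 < z -> z <= 1 -> k%:~R + 1 <= b ->
  z * wgt 1 (below (k - 1)) <= wgt z (below k).
Proof.
move=> z0 z1 bk; rewrite -ler_pdivlMl //; apply: wgt_transfer.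
- by rewrite invr_ge0 ltW.
- exact: below_inj.
- exact: below_inj.
(* Cell k - 1 - n is read as the predecessor of cell k - n. *)
move=> n; rewrite ler_pdivlMl // !wgt_mu_itv // [k - 1 - _]addrAC
  (intrB _ (k - n%:Z)) subrK.
apply: incr_prev; rewrite ?intrB //.
have : 0 <= n%:~R :> R by rewrite ler0z.
lra.
Qed.

(** With k the floor of [b], the cells from k + 1 on lie in the decreasing region and those up to k
    - 1 in the increasing one. In the upper bound the terms left over are J_k and J_(k+1); in the
    lower bound they are z I_(k-1) and z I_k. Each is at most z M. *)
Lemma wgt_bound z : 0 < z -> z <= 1 -> `|wgt z setT - z| <= 2 * z * M.
Proof.
move=> z0 z1; set k := Num.floor b.
have kb : k%:~R <= b by exact: floor_le.
have bk : b <= (k + 1)%:~R by apply/ltW; exact: floorD1_gt.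
have ltk : (k - 1)%:~R + 1 <= b by rewrite intrB subrK.
have le_M j : wgt z [set j] <= z * M by rewrite wgt_mu_itv // mu_itv_le_M.
have le_M1 j : wgt 1 [set j] <= M.
  by rewrite wgt_mu_itv // -[leRHS]mul1r mu_itv_le_M.
have := wgt_above_ge z0 z1 bk.
have := wgt_above_le z0 z1 bk.
have := wgt_below_le z0 z1 ltk.
have := wgt_below_ge z0 z1 ltk.
have := wgtT z k; have := wgtT 1 k; rewrite wgt1T.
have := wgt_above z k; have := wgt_above 1 k.
have := wgt_above z (k + 1); have := wgt_below 1 (k - 1).
have := wgt_ge0 z [set k].
have := wgt_ge0 1 [set k].
have := wgt_ge0 z [set (k + 1)].
have := wgt_ge0 1 [set (k - 1)].
have := le_M k; have := le_M (k + 1).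
have := ler_wpM2l (ltW z0) (le_M1 k).
have := ler_wpM2l (ltW z0) (le_M1 (k - 1)).
rewrite ler_norml => *; apply/andP; split; nra.
Qed.

(** If M <= 0, every unit cell is null, hence so are both half-lines of cells, contradicting total
    mass 1. *)
Lemma mass_bound_gt0 : 0 < M.
Proof.
rewrite ltNge; apply/negP => M0.
(* The factor 0 puts nullity in the form that [wgt_transfer] sums. *)
have le0 k : wgt 1 [set k] <= 0 * wgt 1 [set k].
  rewrite mul0r wgt_mu_itv //; apply: le_trans M0.
  by rewrite -[leRHS]mul1r mu_itv_le_M.
have := wgtT 1 0; rewrite wgt1T.
have := @wgt_transfer 0 1 1 _ _ (lexx 0) (@above_inj 0) (@above_inj 0)
  (fun n => le0 _).
have := @wgt_transfer 0 1 1 _ _ (lexx 0) (@below_inj (0 - 1))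
  (@below_inj (0 - 1)) (fun n => le0 _).
rewrite !mul0r -/(above 0) -/(below (0 - 1)).
lra.
Qed.

End Windows.

(** * Integration of c / x away from the origin *)

Lemma continuous_cst_div (R : realType) (c : R) (D : set R) :
  D `<=` [set x | 0 < x] -> {within D, continuous (fun x => c / x)}.
Proof.
move=> D0; apply: continuous_in_subspaceT => x; rewrite inE => /D0 /= x0.
by apply: cvgM; [exact: cvg_cst|apply: cvgV; [rewrite gt_eqF|exact: cvg_id]].
Qed.

Lemma measurable_cst_div (R : realType) (c p q : R) : 0 < p ->
  measurable_fun `[p, q[%classic (fun x => (c / x)%:E).
Proof.
move=> p0; apply/measurable_EFinP.
apply: subspace_continuous_measurable_fun => //.
apply: continuous_cst_div => x /=; rewrite in_itv /= => /andP[px _].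
exact: lt_le_trans px.
Qed.

Lemma integral_cst_div (R : realType) (c p q : R) : 0 < p -> p <= q ->
  (\int[lebesgue_measure]_(x in `[p, q[) (c / x)%:E = (c * (ln q - ln p))%:E)%E.
Proof.
(* The fundamental theorem of calculus, with primitive c ln, is applied for p < q; the empty
   interval is treated apart. *)
move=> p0; rewrite le_eqVlt => /predU1P[<-|pq].
  by rewrite set_itvco0 ?integral_set0 ?subrr ?mulr0.
have gt0 x : x \in `[p, q] -> 0 < x.
  by rewrite in_itv /= => /andP[px _]; exact: lt_le_trans px.
have dln x : x \in `[p, q] -> is_derive x 1 (c \*: @ln R)%R (c / x).
  by move=> /gt0 x0; exact: is_deriveZ (is_derive1_ln x0).
have cln x : x \in `[p, q] -> {for x, continuous (c \*: @ln R)%R}.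
  by move=> /gt0 x0; apply: cvgM; [exact: cvg_cst|exact: continuous_ln].
have pin : p \in `[p, q] by rewrite in_itv /= lexx ltW.
have qin : q \in `[p, q] by rewrite in_itv /= lexx ltW.
rewrite integral_itv_bndo_bndc; last exact: measurable_cst_div.
rewrite (continuous_FTC2 pq (continuous_cst_div gt0) (F := (c \*: @ln R)%R)) /=.
- by rewrite -EFinB mulrBr.
- split.
  + by move=> x /subset_itv_oo_cc/dln xin; exact: ex_derive.
  + exact: cvg_at_right_filter (cln p pin).
  + exact: cvg_at_left_filter (cln q qin).
- move=> x /subset_itv_oo_cc/dln xin; rewrite derive1E.
  exact: derive_val.
Qed.

(** * Powers of ten and decimal logarithms *)

Section Pow10.
Context {R : realType}.
Implicit Types s t u v x c : R.

Definition pow10 t : R := expR (t * ln 10).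

Lemma ln10_gt0 : 0 < ln 10 :> R.
Proof. by rewrite ln_gt0 // ltr1n. Qed.

Lemma pow10_gt0 t : 0 < pow10 t.
Proof. exact: expR_gt0. Qed.

Lemma ler_pow10 s t : (pow10 s <= pow10 t) = (s <= t).
Proof. by rewrite ler_expR ler_pM2r // ln10_gt0. Qed.

Lemma log10K x : 0 < x -> pow10 (log10 x) = x.
Proof.
by move=> x0; rewrite /pow10 divfK ?gt_eqF ?ln10_gt0 // lnK.
Qed.

(** The integrand is the image of the constant density c under t -> 10^t. This explicit integral
    stands in for a general change of variables. *)
Lemma integral_pow10 u v c : u <= v ->
  (\int[lebesgue_measure]_(x in `[pow10 u, pow10 v[) (c / ln 10 / x)%:E =
   (c * (v - u))%:E)%E.
Proof.
move=> uv; rewrite integral_cst_div ?pow10_gt0 ?ler_pow10 // !expRK.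
by rewrite -mulrBl mulrACA mulVf ?mulr1 // gt_eqF // ln10_gt0.
Qed.

Lemma log10_itv u v x : x \in `[pow10 u, pow10 v[ ->
  0 < x /\ u <= log10 x <= v.
Proof.
rewrite in_itv /= => /andP[ux xv].
have x0 : 0 < x by apply: lt_le_trans ux; exact: pow10_gt0.
by split=> //; rewrite -ler_pow10 -[X in _ && X]ler_pow10 log10K // ux ltW.
Qed.

End Pow10.

(** * The law of log X and its density *)

Section LogMass.
Context (R : realType) (d : measure_display) (T : measurableType d).
Context (P : probability T R) (X : {RV P >-> R}) (f : R -> R).
Hypothesis X0 : positive_RV X.
Hypothesis fX : has_pdf X f.

Definition log_law : probability R R :=
  distribution P ((@log10 R \o X)%FUN : {RV P >-> R}).

Definition log_density (t : R) : R := ln 10 * (pow10 t * f (pow10 t)).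

(** The events u <= log X < v and 10^u <= X < 10^v agree where X > 0. They can differ only where X
    <= 0, where [log10] takes its default value 0; that set is negligible. *)
Lemma log_law_itv (u v : R) :
  log_law `[u, v[%classic =
    (\int[lebesgue_measure]_(x in `[pow10 u, pow10 v[) (f x)%:E)%E.
Proof.
have [mf f0 <-] := fX; last exact: measurable_itv.
pose A := [set w | log10 (X w) \in `[u, v[].
pose B := [set w | X w \in `[pow10 u, pow10 v[].
change (P A = P B).
have mA : measurable A.
  rewrite -[A]setTI; pose Y : {RV P >-> R} := (@log10 R \o X)%FUN.
  exact: (@measurable_funP _ _ _ _ _ Y measurableT _ (measurable_itv `[u, v[)).
have mB : measurable B.
  rewrite -[B]setTI.
  exact: (@measurable_funP _ _ _ _ _ X measurableT _
    (measurable_itv `[pow10 u, pow10 v[)).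
have iff w : 0 < X w -> A w <-> B w.
  move=> Xw0; rewrite /A /B /= !in_itv /= -{3 4}(log10K Xw0).
  by rewrite ler_pow10 !ltNge ler_pow10.
(* On [B] positivity of X is automatic since 10^u > 0, so only the part of [A] outside [B] has to be
   shown negligible. *)
have AB : A `&` B = B.
  apply/setIidr => w Bw; apply/iff => //; move: Bw; rewrite /B /= in_itv /=.
  by move=> /andP[+ _]; apply: lt_le_trans; exact: pow10_gt0.
rewrite (measureDI P mA mB) AB measure_negligible ?add0e //.
  exact: measurableD.
apply: negligibleS X0 => w [Aw nBw] /= Xw0.
by apply/nBw/iff.
Qed.

Lemma pdf_log_density (x : R) : 0 < x ->
  f x = log_density (log10 x) / ln 10 / x.
Proof.
move=> x0; rewrite /log_density log10K // [ln 10 * _]mulrC.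
rewrite mulfK ?gt_eqF ?ln10_gt0 //.
by rewrite mulrC mulKf // gt_eqF.
Qed.

Lemma log_density_ge0 t : 0 <= log_density t.
Proof.
have [_ f0 _] := fX.
by rewrite !mulr_ge0 // ?ltW ?ln10_gt0 ?pow10_gt0.
Qed.

Lemma measurable_pdf (D : set R) : measurable D ->
  measurable_fun D (fun x => (f x)%:E).
Proof.
by have [mf _ _] := fX => mD; apply/measurable_EFinP; exact: measurable_funS mf.
Qed.

Lemma log_law_le (u v c : R) : u <= v ->
  (forall t, u <= t <= v -> log_density t <= c) ->
  mu_itv log_law u v <= c * (v - u).
Proof.
move=> uv hc.
have c0 : 0 <= c.
  by apply: le_trans (log_density_ge0 u) (hc u _); rewrite lexx.
have [_ f0 _] := fX.
rewrite -lee_fin fineK ?fin_num_measure // log_law_itv -integral_pow10 //.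
apply: ge0_le_integral => //.
- by move=> x _; rewrite lee_fin.
- exact: measurable_pdf.
- exact: measurable_cst_div (pow10_gt0 u).
- move=> x /log10_itv[x0 /hc xc]; rewrite lee_fin pdf_log_density //.
  by rewrite !ler_pM2r ?invr_gt0 ?ln10_gt0.
Qed.

Lemma log_law_ge (u v c : R) : u <= v ->
  (forall t, u <= t <= v -> c <= log_density t) ->
  c * (v - u) <= mu_itv log_law u v.
Proof.
(* A negative c gives a nonpositive left-hand side; otherwise the minorant is nonnegative, as the
   comparison of integrals requires. *)
move=> uv hc; have [c0|/ltW c0] := leP 0 c; last first.
  by apply: (@le_trans _ _ 0); [rewrite mulr_le0_ge0 ?subr_ge0|exact: fine_ge0].
rewrite -lee_fin fineK ?fin_num_measure // log_law_itv -integral_pow10 //.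
apply: ge0_le_integral => //.
- move=> x /log10_itv[x0 _].
  by rewrite lee_fin !divr_ge0 // ltW // ln10_gt0.
- exact: measurable_cst_div (pow10_gt0 u).
- exact: measurable_pdf.
- move=> x /log10_itv[x0 /hc xc]; rewrite lee_fin pdf_log_density //.
  by rewrite !ler_pM2r ?invr_gt0 ?ln10_gt0.
Qed.

Context (m a : R).
Hypothesis fma : unimodal_at f m a.

Lemma log_density_le t : log_density t <= ln 10 * m.
Proof.
by have [_ fm _ _ _] := fma; rewrite ler_pM2l ?ln10_gt0 // fm // pow10_gt0.
Qed.

Lemma log_density_incr s t : s <= t -> t <= log10 a ->
  log_density s <= log_density t.
Proof.
have [a0 _ _ incr _] := fma => st ta.
have ta' : pow10 t <= a by rewrite -(log10K a0) ler_pow10.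
have st' : pow10 s <= pow10 t by rewrite ler_pow10.
rewrite ler_pM2l ?ln10_gt0 //; apply: incr => //.
  by rewrite in_itv /= pow10_gt0 (le_trans st').
by rewrite in_itv /= pow10_gt0.
Qed.

Lemma log_density_decr s t : log10 a <= s -> s <= t ->
  log_density t <= log_density s.
Proof.
have [a0 _ _ _ decr] := fma => as_ st.
have as' : a <= pow10 s by rewrite -(log10K a0) ler_pow10.
have st' : pow10 s <= pow10 t by rewrite ler_pow10.
rewrite ler_pM2l ?ln10_gt0 //; apply: decr => //.
  by rewrite in_itv /= as'.
by rewrite in_itv /= (le_trans as').
Qed.

(** The equality m = a f(a) gives only m >= 0. Strictness comes from the total mass, and is what
    makes the final inequality strict. *)
Lemma pdf_max_gt0 : 0 < m.
Proof.
rewrite -(@pmulr_rgt0 _ (ln 10)) ?ln10_gt0 //.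
exact: (mass_bound_gt0 log_density_le log_law_le).
Qed.

Lemma fracpart_log10_bound z : 0 < z -> z <= 1 ->
  `|wgt log_law z setT - z| <= 2 * z * (ln 10 * m).
Proof.
exact: (wgt_bound log_density_le log_density_incr log_density_decr
          log_law_le log_law_ge).
Qed.

Lemma prob_fracpart_log10 z :
  P [set w | fracpart (log10 (X w)) < z] = (wgt log_law z setT)%:E.
Proof.
rewrite -wgtE; congr (P _); apply/seteqP; split=> w //=.
by move=> [_ wz].
Qed.

End LogMass.

(** * Distribution functions and comparison with the uniform law *)

Definition clamp01 (R : realType) (r : R) : R := Num.max 0 (Num.min r 1).

Lemma clamp01_le1 (R : realType) (r : R) : clamp01 r <= 1.
Proof. by rewrite ge_max ler01 ge_min lexx orbT. Qed.

Lemma uniform_probNy (R : realType) (r : R) :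
  uniform_prob (@ltr01 R) `]-oo, r]%classic = (clamp01 r)%:E.
Proof.
rewrite /uniform_prob integral_uniform_pdf.
rewrite (_ : _ `&` _ = `[0, Num.min r 1]%classic); last first.
  apply/seteqP; split=> x /=; rewrite !in_itv /= le_min.
    by move=> [-> /andP[-> ->]].
  by move=> /andP[-> /andP[-> ->]].
rewrite (eq_integral (cst 1%E)); last first.
  move=> x; rewrite inE /= in_itv /= le_min => /andP[x0 /andP[_ x1]].
  by rewrite /uniform_pdf x0 x1 subr0 invr1.
rewrite integral_cst //= lebesgue_measure_itv /= lte_fin mul1e /clamp01.
by case: ltP => r0; rewrite ?sube0.
Qed.

(** The bound does not depend on [r] or [a], as needed to squeeze along a sequence. The event {log
    X} <= r is enclosed between events {log X} < z, to which the window bound applies. *)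
Lemma cdf_fracpart_log10_bound (R : realType) (d : measure_display)
    (T : measurableType d) (P : probability T R) (X : {RV P >-> R})
    (f : R -> R) (m a r : R) :
  positive_RV X -> has_pdf X f -> unimodal_at f m a ->
  `|fine (cdf (fracpart_log10 X) r) - clamp01 r| <= 2 * (ln 10 * m).
Proof.
move=> X0 fX fma.
have M0 : 0 < ln 10 * m.
  by rewrite mulr_gt0 ?ln10_gt0 //; exact: (pdf_max_gt0 X0 fX fma).
have bound z : 0 < z -> z <= 1 ->
    z - 2 * (ln 10 * m) <= wgt (log_law X) z setT <= z + 2 * (ln 10 * m).
  move=> z0 z1.
  have := fracpart_log10_bound X0 fX fma z0 z1.
  have : 2 * z * (ln 10 * m) <= 2 * (ln 10 * m).
    by rewrite -mulrA (mulrCA 2) ler_piMl // mulr_ge0 // ltW.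
  by rewrite ler_norml => h /andP[h1 h2]; apply/andP; split; lra.
have mY (D : set R) : measurable D -> measurable (fracpart_log10 X @^-1` D).
  by move=> mD; rewrite -[X in measurable X]setTI; exact: measurable_funP.
have cdfE :
  cdf (fracpart_log10 X) r = P [set w | fracpart (log10 (X w)) <= r] by [].
have cdf_fin : cdf (fracpart_log10 X) r \is a fin_num.
  by rewrite fin_num_measure.
have cdf0 : 0 <= fine (cdf (fracpart_log10 X) r) by exact: fine_ge0.
have cdf1 : fine (cdf (fracpart_log10 X) r) <= 1.
  by rewrite -lee_fin fineK // probability_le1.
have mlt z : measurable [set w | fracpart (log10 (X w)) < z].
  rewrite (_ : mkset _ = fracpart_log10 X @^-1` `]-oo, z[%classic).
    exact: mY.
  by apply/seteqP; split=> w /=; rewrite in_itv.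
have mle z : measurable [set w | fracpart (log10 (X w)) <= z].
  rewrite (_ : mkset _ = fracpart_log10 X @^-1` `]-oo, z]%classic).
    exact: mY.
  by apply/seteqP; split=> w /=; rewrite in_itv.
have cdf_le z : r < z ->
    fine (cdf (fracpart_log10 X) r) <= wgt (log_law X) z setT.
  move=> rz; rewrite -lee_fin (fineK cdf_fin) cdfE -prob_fracpart_log10.
  by apply: le_measure; rewrite ?inE // => w /= /le_lt_trans; exact.
have cdf_ge z : z <= r ->
    wgt (log_law X) z setT <= fine (cdf (fracpart_log10 X) r).
  move=> rz; rewrite -lee_fin (fineK cdf_fin) cdfE -prob_fracpart_log10.
  by apply: le_measure; rewrite ?inE // => w /= /ltW /le_trans; exact.
have c1 := clamp01_le1 r.
rewrite ler_norml; apply/andP; split.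
  (* When the clamped value is positive, it lies in ]0, 1] and is at most [r], so it can serve as
     z. *)
  have [c0|c0] := leP (clamp01 r) 0; first by lra.
  have cr : clamp01 r <= r.
    move: c0; rewrite /clamp01 lt_max ltxx lt_min /= => /andP[/ltW r0 _].
    by rewrite ge_max r0 ge_min lexx.
  by have /andP[] := bound _ c0 c1; have := cdf_ge _ cr; lra.
have [r0|r0] := ltP r 0.
  suff -> : fine (cdf (fracpart_log10 X) r) = 0.
    have : 0 <= clamp01 r by rewrite /clamp01 le_max lexx.
    lra.
  rewrite cdfE (_ : mkset _ = set0) ?measure0 //.
  apply/seteqP; split=> w //= /le_lt_trans/(_ r0).
  by rewrite ltNge fracpart_ge0.
have [r1|r1] := leP 1 r.
  by rewrite /clamp01 min_r // max_r //; lra.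
rewrite lerBlDl /clamp01 (min_l (ltW r1)) max_r //.
(* Passing from <= r to < z needs z slightly above [r]; truncation at 1 keeps it in ]0, 1], and e is
   arbitrary. *)
apply/ler_addgt0Pr => e e0.
have re : r < Num.min (r + e) 1 by rewrite lt_min r1 ltrDl e0.
have re1 : Num.min (r + e) 1 <= 1 by rewrite ge_min lexx orbT.
have /andP[_] := bound _ (le_lt_trans r0 re) re1.
have := cdf_le _ re.
have : Num.min (r + e) 1 <= r + e by rewrite ge_min lexx.
lra.
Qed.

Unset Implicit Arguments.

Theorem theorem1 (R : realType) :
  (forall (d : measure_display) (T : measurableType d) (P : probability T R)
      (X : {RV P >-> R}) (f : R -> R) (m : R),
    positive_RV X -> has_pdf X f -> (exists a : R, unimodal_at f m a) ->
    forall z : R, 0 < z <= 1 ->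
      (`| P [set w | fracpart (log10 (X w)) < z]%R - z%:E |
         < (2 * ln 10 * m)%:E)%E)
  /\
  (forall (d : nat -> measure_display) (T : forall n, measurableType (d n))
      (P : forall n, probability (T n) R) (X : forall n, {RV (P n) >-> R})
      (f : nat -> R -> R) (m : nat -> R),
    (forall n, positive_RV (X n)) ->
    (forall n, has_pdf (X n) (f n)) ->
    (forall n, exists a : R, unimodal_at (f n) (m n) a) ->
    m n @[n --> \oo] --> 0 ->
    cvg_in_law (fun n => fracpart_log10 (X n)) (uniform_prob (@ltr01 R))).
Proof.
have L0 := @ln10_gt0 R.
split.
  move=> d T P X f m X0 fX [a fma] z /andP[z0 z1].
  have m0 := pdf_max_gt0 X0 fX fma.
  have M0 : 0 < ln 10 * m by rewrite mulr_gt0.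
  rewrite prob_fracpart_log10 -EFinB abse_EFin lte_fin.
  have [z1'|z1'] := ltP z 1.
    apply: le_lt_trans (fracpart_log10_bound X0 fX fma z0 z1) _.
    by have : z * (ln 10 * m) < ln 10 * m; [rewrite gtr_pMl|lra].
  have -> : z = 1 by apply/le_anti/andP.
  by rewrite wgt1T subrr normr0 -mulrA mulr_gt0.
move=> d T P X f m X0 fX fm m0 r _.
suff : cdf (fracpart_log10 (X n)) r @[n --> \oo] --> (clamp01 r)%:E.
  by rewrite -uniform_probNy.
apply: cvg_EFin.
  by apply: nearW => n; rewrite fin_num_measure //; exact: measurable_itv.
(* Both bounding sequences tend to [clamp01 r] because m_n tends to 0; the mode a_n is chosen
   separately for each n and does not enter them. *)
apply: (squeeze_cvgr (f := fun n => clamp01 r - 2 * (ln 10 * m n))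
    (h := fun n => clamp01 r + 2 * (ln 10 * m n))).
- apply: nearW => n /=; have [a fma] := fm n.
  by rewrite -ler_distl; exact: cdf_fracpart_log10_bound (X0 n) (fX n) fma.
- rewrite -[X in _ --> X]subr0 -(mulr0 2) -(mulr0 (ln 10)).
  by apply: cvgB; [exact: cvg_cst|apply: cvgMr; exact: cvgMr].
- rewrite -[X in _ --> X]addr0 -(mulr0 2) -(mulr0 (ln 10)).
  by apply: cvgD; [exact: cvg_cst|apply: cvgMr; exact: cvgMr].
Qed.
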